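(* Let $k\in\mathbb{N}$, $k\ge 1$, and let $X=\bigcup_{i=1}^{\infty}\big((i\mathbb{Z})^i\times\mathbb{Z}^k\big)$ (disjoint union over $i$) be equipped with the following metric $d$. For $a=(a_1,\dots,a_{l_1},\bar a_1,\dots,\bar a_k)\in(l_1\mathbb{Z})^{l_1}\times\mathbb{Z}^k$ and $b=(b_1,\dots,b_{l_2},\bar b_1,\dots,\bar b_k)\in(l_2\mathbb{Z})^{l_2}\times\mathbb{Z}^k$ with $l_1\le l_2$, put $a'=(a_1,\dots,a_{l_1},0,\dots,0,\bar a_1,\dots,\bar a_k)\in\mathbb{Z}^{l_2}\times\mathbb{Z}^k$, put $c=0$ if $l_1=l_2$ and $c=l_1+(l_1+1)+\dots+(l_2-1)$ if $l_1<l_2$, and set $d(a,b)=\max\{d_{\max}(a',b),c\}$, where $d_{\max}$ is the maximum metric on $\mathbb{Z}^{l_2}\times\mathbb{Z}^k$. Then $\operatorname{coasdim}(X)=fin+k+1$.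
   Context: Here $j\mathbb{Z}=\{jt : t\in\mathbb{Z}\}$. For subsets $U,V$ of a metric space $(X,d)$, $\operatorname{diam}U=\sup\{d(x,y):x,y\in U\}$ and $d(U,V)=\inf\{d(x,y):x\in U,y\in V\}$. A family $\mathcal{U}$ of subsets is $R$-bounded if $\operatorname{diam}U\le R$ for all $U\in\mathcal{U}$, uniformly bounded if it is $R$-bounded for some $R>0$, and $r$-disjoint if $d(U,V)\ge r$ for all $U\ne V$ in $\mathcal{U}$. $\bigcup\mathcal{U}$ denotes the union of the members of $\mathcal{U}$. $\operatorname{asdim}X\le n$ means: for every $r>0$ there are uniformly bounded, $r$-disjoint families $\mathcal{U}_0,\dots,\mathcal{U}_n$ of subsets of $X$ such that $\bigcup_{i=0}^n\mathcal{U}_i$ covers $X$. $\operatorname{asdim}X=\infty$ if $\operatorname{asdim}X\le n$ holds for no $n$. Complementary-finite asymptotic dimension: $\operatorname{coasdim}(X)\le fin+k$ (for $k\in\mathbb{N}$) means that for every $n\in\mathbb{N}$ there exist $R>0$, $m\in\mathbb{N}$ and $n$-disjoint, $R$-bounded families $\mathcal{U}_1,\dots,\mathcal{U}_k$ of subsets of $X$ such that $\operatorname{asdim}\big(X\setminus\bigcup(\bigcup_{i=1}^k\mathcal{U}_i)\big)\le m$. For $k>1$, $\operatorname{coasdim}(X)=fin+k$ means $\operatorname{coasdim}(X)\le fin+k$ and not $\operatorname{coasdim}(X)\le fin+k-1$. *)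

(* Defs.v *)
From HB Require Import structures.
From mathcomp Require Import all_boot all_order all_algebra.
From mathcomp Require Import zify.
From mathcomp Require Import all_classical all_reals all_analysis.

Set Implicit Arguments.
Unset Strict Implicit.
Unset Printing Implicit Defensive.

Import Order.TTheory GRing.Theory Num.Theory.

Local Open Scope classical_set_scope.
Local Open Scope ring_scope.

Section asymptotic_dimension.
Context {R : realType} {X : metricType R}.
Implicit Types (U V A : set X) (F : set (set X)) (r : R).

(* Extended-real valued: diam set0 = -oo and setdist set0 V = +oo, so the empty
   set never obstructs boundedness or disjointness. *)
Definition diam U : \bar R :=
  ereal_sup [set (mdist x y)%:E | x in U & y in U].

Definition setdist U V : \bar R :=
  ereal_inf [set (mdist x y)%:E | x in U & y in V].

Definition bounded_family r F := forall U, F U -> (diam U <= r%:E)%E.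

Definition uniformly_bounded F := exists2 r, 0 < r & bounded_family r F.

Definition disjoint_family r F :=
  forall U V, F U -> F V -> U <> V -> (r%:E <= setdist U V)%E.

(* asdim A <= n for the subspace A of X: since A carries the restricted metric,
   the families of subsets of A are compared with the distance of X. *)
Definition asdim_le A (n : nat) := forall r, 0 < r ->
  exists F : 'I_n.+1 -> set (set X),
    (forall i, [/\ forall U, F i U -> U `<=` A,
                   uniformly_bounded (F i) &
                   disjoint_family r (F i)]) /\
    A `<=` \bigcup_i \bigcup_(U in F i) U.

End asymptotic_dimension.

Section complementary_finite_asymptotic_dimension.
Context {R : realType} (X : metricType R).

(* coasdim X <= fin + k *)
Definition coasdim_le (k : nat) := forall n : nat,
  exists (r : R) (m : nat) (F : 'I_k -> set (set X)),
    [/\ 0 < r,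
        forall i, disjoint_family n%:R (F i) /\ bounded_family r (F i) &
        asdim_le ([set: X] `\` \bigcup_i \bigcup_(U in F i) U) m].

(* coasdim X = fin + k; only meaningful for 1 < k. *)
Definition coasdim_eq (k : nat) := coasdim_le k /\ ~ coasdim_le k.-1.

End complementary_finite_asymptotic_dimension.

(* (jZ)^j *)
Definition scaled_lattice (j : nat) : Type :=
  {u : 'rV[int]_j | [forall i : 'I_j, (j%:Z %| u ord0 i)%Z]}.
HB.instance Definition _ j := Choice.on (scaled_lattice j).

(* The disjoint union of the (iZ)^i x Z^k over i >= 1: the component of index
   n : nat is the one with i = n.+1.  The phantom argument R only records the
   field in which the distance takes its values. *)
Definition lattice_union (R : realType) (k : nat) : Type :=
  {n : nat & (scaled_lattice n.+1 * 'rV[int]_k)%type}.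
HB.instance Definition _ R k := Choice.on (lattice_union R k).

Section lattice_union_metric.
Context {R : realType} {k : nat}.
Implicit Types (a b : lattice_union R k).

Definition level a : nat := (tag a).+1.

Definition lattice_part a : 'rV[int]_(level a) := val (tagged a).1.

Definition bar_part a : 'rV[int]_k := (tagged a).2.

Definition pad l1 l2 (u : 'rV[int]_l1) : 'rV[int]_l2 :=
  \row_(i < l2) oapp (u 0) 0 (insub (val i)).

Definition dmax l (u v : 'rV[int]_l * 'rV[int]_k) : nat :=
  maxn (\max_(i < l) `|u.1 ord0 i - v.1 ord0 i|%N)
       (\max_(j < k) `|u.2 ord0 j - v.2 ord0 j|%N).

(* d(a, b) for level a <= level b; the sum is empty when the levels agree. *)
Definition dist_ordered a b : nat :=
  maxn (dmax (pad (level b) (lattice_part a), bar_part a)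
             (lattice_part b, bar_part b))
       (\sum_(level a <= i < level b) i).

Definition lattice_union_dist a b : nat :=
  if (level a <= level b)%N then dist_ordered a b else dist_ordered b a.

Let co a (i : nat) : int := oapp (lattice_part a 0) 0 (insub i).

Let tri (n : nat) : nat := (\sum_(0 <= i < n) i)%N.

Let tri_cat m n : (m <= n)%N -> (tri m + \sum_(m <= i < n) i = tri n)%N.
Proof. by move=> mn; rewrite /tri [RHS](@big_cat_nat _ _ _ m). Qed.

Let co_out a i : (level a <= i)%N -> co a i = 0.
Proof. by move=> ai; rewrite /co insubF// ltnNge ai. Qed.

Let dist_orderedP a b r : (level a <= level b)%N ->
  (dist_ordered a b <= r)%N <->
  [/\ forall i, (`|co a i - co b i| <= r)%N,
      forall j, (`|bar_part a ord0 j - bar_part b ord0 j| <= r)%N &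
      (tri (level a) <= tri (level b) + r)%N /\
      (tri (level b) <= tri (level a) + r)%N].
Proof.
move=> ab; have cE := tri_cat ab.
rewrite /dist_ordered /dmax/= !geq_max.
have P1 (i : 'I_(level b)) : pad (level b) (lattice_part a) 0 i = co a i.
  by rewrite mxE.
have P2 (i : 'I_(level b)) : lattice_part b 0 i = co b i.
  by rewrite /co valK.
split.
  move=> /andP[/andP[/bigmax_leqP h1 /bigmax_leqP h2] h3]; split.
  - move=> i; case: (ltnP i (level b)) => ib; last first.
      by rewrite !co_out// (leq_trans ab).
    by have := h1 (Ordinal ib) isT; rewrite P1 P2.
  - by move=> j; exact: h2.
  - by lia.
move=> [h1 h2 h3]; apply/andP; split; last by lia.
apply/andP; split; apply/bigmax_leqP => i _; last exact: h2.
by rewrite P1 P2; exact: h1.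
Qed.

Let distP a b r : (lattice_union_dist a b <= r)%N <->
  [/\ forall i, (`|co a i - co b i| <= r)%N,
      forall j, (`|bar_part a ord0 j - bar_part b ord0 j| <= r)%N &
      (tri (level a) <= tri (level b) + r)%N /\
      (tri (level b) <= tri (level a) + r)%N].
Proof.
rewrite /lattice_union_dist; case: (leqP (level a) (level b)) => ab.
  exact: dist_orderedP.
rewrite dist_orderedP; last exact: ltnW.
split => -[h1 h2 h3]; (split;
  [move=> i; have := h1 i|move=> j; have := h2 j|]); lia.
Qed.

Lemma lattice_union_distxx a : lattice_union_dist a a = 0%N.
Proof.
apply/eqP; rewrite -leqn0; apply/distP; split; last by lia.
  by move=> i; rewrite subrr.
by move=> j; rewrite subrr.
Qed.

Lemma lattice_union_dist_eq0 a b : lattice_union_dist a b = 0%N -> a = b.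
Proof.
move=> /eqP; rewrite -leqn0 => /distP[h1 h2 h3].
have rab : level a = level b.
  have tS n : (tri n.+2 = tri n.+1 + n.+1)%N by rewrite /tri big_nat_recr.
  have tm m n : (m < n)%N -> (tri m.+1 < tri n.+1)%N.
    elim: n => // n ih; rewrite ltnS leq_eqVlt => /orP[/eqP->|/ih];
    rewrite tS; lia.
  move: h3; rewrite /level; case: (ltngtP (tag a) (tag b)) => [/tm|/tm|->//];
    lia.
case: a b rab h1 h2 {h3} => [n [u v]] [n' [u' v']] [nn']; rewrite /= in nn' *.
subst n'; move=> h1 h2.
have -> : u = u'.
  apply/val_inj/rowP => i; have := h1 i.
  by rewrite /co/= !valK/= leqn0 absz_eq0 subr_eq0 => /eqP.
suff -> : v = v' by [].
apply/rowP => j; have := h2 j.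
by rewrite leqn0 absz_eq0 subr_eq0 => /eqP.
Qed.

Lemma lattice_union_distC a b : lattice_union_dist a b = lattice_union_dist b a.
Proof.
have le x y : (lattice_union_dist x y <= lattice_union_dist y x)%N.
  have /distP[h1 h2 h3] := leqnn (lattice_union_dist y x).
  by apply/distP; split;
    [move=> i; have := h1 i|move=> j; have := h2 j|]; lia.
by apply/eqP; rewrite eqn_leq !le.
Qed.

Lemma lattice_union_dist_triangle b a c :
  (lattice_union_dist a c <=
   lattice_union_dist a b + lattice_union_dist b c)%N.
Proof.
have /distP[h1 h2 h3] := leqnn (lattice_union_dist a b).
have /distP[g1 g2 g3] := leqnn (lattice_union_dist b c).
by apply/distP; split;
  [move=> i; have := h1 i; have := g1 i
  |move=> j; have := h2 j; have := g2 j|]; lia.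
Qed.

Let dR a b : R := (lattice_union_dist a b)%:R.

Let dRxx a : dR a a = 0.
Proof. by rewrite /dR lattice_union_distxx. Qed.

Let dR_eq0 a b : dR a b = 0 -> a = b.
Proof. by move=> /eqP; rewrite pnatr_eq0 => /eqP/lattice_union_dist_eq0. Qed.

Let dRC a b : dR a b = dR b a.
Proof. by rewrite /dR lattice_union_distC. Qed.

Let dR_triangle b a c : dR a c <= dR a b + dR b c.
Proof. by rewrite /dR -natrD ler_nat lattice_union_dist_triangle. Qed.

HB.instance Definition _ := @isMetric.Build R (lattice_union R k)
  dR dRxx dR_eq0 dRC dR_triangle.

Lemma mdist_lattice_unionE a b : mdist a b = (lattice_union_dist a b)%:R.
Proof. by []. Qed.

End lattice_union_metric.

(* Main.v *)
(** Lower bound.  Suppose k families, 3-disjoint and R-bounded, leave a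
    complement A of asymptotic dimension at most m, and look at the component
    (lZ)^l x Z^k with l = m + 1.  By Lebesgue's covering theorem for Z^k, the k
    families cannot cover a large box in any fibre {a} x Z^k, so that A contains
    a point s(a) at bounded height over every a in (lZ)^l.  The section s is a
    quasi-isometric embedding of Z^(m+1) into A, and the same covering theorem
    shows that m + 1 families at a large scale cannot cover its image.

    The covering theorem is reduced, as Hurewicz does, to a discrete
    Poincare-Miranda theorem: if w_1, ..., w_d are 0/1-valued on [0, N]^d with
    w_i = 1 on the face x_i = 0 and w_i = 0 on the face x_i = N, then on some
    unit cube no w_i is constant.  That theorem follows from Stokes' formula
    modulo 2 for the cup product dw_1 ... dw_d.

    Upper bound.  Above level n, distinct fibres {a} x Z^k are more than n
    apart, so that k + 1 families of boxes in Z^k do for all of them at once; up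
    to level n the space sits coarsely in Z^(n + k). *)
Require Import Defs.
From mathcomp Require Import all_boot all_order all_algebra.
From mathcomp Require Import zify boolp.

Set Implicit Arguments.
Unset Strict Implicit.
Unset Printing Implicit Defensive.

Import Order.TTheory GRing.Theory Num.Theory.

Local Open Scope ring_scope.

(** * A discrete Poincare-Miranda theorem *)

Lemma addbool_self (b : bool) : b + b = 0. Proof. exact: addbb. Qed.

(** [bool] serves as the field with two elements, where the terms at (i, j) and (j, i) cancel. *)
Lemma sum_offdiag_sym_eq0 d (I : {set 'I_d}) (f : 'I_d -> 'I_d -> bool) :
  (forall i j, f i j = f j i) -> \sum_(i in I) \sum_(j in I :\ i) f i j = 0.
Proof.
move=> fC; have split_lt i : \sum_(j in I :\ i) f i j =
    \sum_(j in I | (j < i)%N) f i j + \sum_(j in I | (i < j)%N) f i j.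
  rewrite (bigID (fun j : 'I_d => (j < i)%N)) /=; congr (_ + _);
    apply: eq_bigl => j; rewrite !inE -(inj_eq val_inj)/=;
    by case: ltngtP; rewrite ?andbT ?andbF.
under eq_bigr do rewrite split_lt.
rewrite big_split/= [X in _ + X](exchange_big_dep (mem I))//=; last first.
  by move=> i j _ /andP[].
rewrite -big_split big1//= => i iI.
rewrite [X in _ + X](_ : _ = \sum_(j in I | (j < i)%N) f i j) ?addbool_self//.
by apply: eq_big => [j|j _]; [rewrite iI|exact: fC].
Qed.

Section cube.
Variable d : nat.
Implicit Types (x y : 'I_d -> nat) (i j : 'I_d) (I : {set 'I_d}).
Implicit Types (s : seq 'I_d) (h w : ('I_d -> nat) -> bool).

Definition set_coord x i t : 'I_d -> nat := fun j => if j == i then t else x j.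

Definition step x i := set_coord x i (x i).+1.

Lemma set_coordE x i t : set_coord x i t i = t.
Proof. by rewrite /set_coord eqxx. Qed.

Lemma set_coord_neq x i t j : j != i -> set_coord x i t j = x j.
Proof. by rewrite /set_coord => /negPf->. Qed.

Lemma step_neq x i j : j != i -> step x i j = x j.
Proof. exact: set_coord_neq. Qed.

Lemma stepC x i j : step (step x i) j = step (step x j) i.
Proof.
have [->//|ij] := eqVneq i j.
apply/funext => l; have ji : j != i by rewrite eq_sym.
rewrite /step (set_coord_neq _ _ ji) (set_coord_neq _ _ ij) /set_coord.
by case: (eqVneq l i) => [->|//]; rewrite (negPf ij).
Qed.

(* The cup product dw_1 ... dw_n modulo 2 of the differentials of the functions
   in [ws], evaluated on the unit cube at [x] spanned by the directions in [I]:
   the sum over all monotone edge paths from [x] to the opposite vertex of the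
   product of the increments of the w_j along the path.  It is [0] if
   [size ws != #|I|]. *)
Fixpoint cup (ws : seq (('I_d -> nat) -> bool)) I x : bool :=
  if ws is w :: ws' then
    \sum_(i in I) (w x + w (step x i)) * cup ws' (I :\ i) (step x i)
  else I == set0.

Lemma setD1C (I : {set 'I_d}) i j : I :\ i :\ j = I :\ j :\ i.
Proof. by apply/setP => l; rewrite !inE andbCA. Qed.

(* The cochain dw_1 ... dw_n is closed: terms that are symmetric in the first
   two directions of a path cancel in pairs. *)
Lemma cup_closed ws I x :
  \sum_(i in I) cup ws (I :\ i) (step x i) = \sum_(i in I) cup ws (I :\ i) x.
Proof.
elim: ws I x => [//|w ws IH] I x /=.
transitivity (\sum_(i in I) \sum_(j in I :\ i)
    w (step x i) * cup ws (I :\ i :\ j) (step x i)).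
  under eq_bigr do under eq_bigr do rewrite mulrDl.
  under eq_bigr do rewrite big_split/=.
  rewrite big_split/= [X in _ + X]sum_offdiag_sym_eq0 ?addr0; last first.
    by move=> i j; rewrite stepC setD1C.
  by apply: eq_bigr => i _; rewrite -!mulr_sumr IH.
under [RHS]eq_bigr do under eq_bigr do rewrite mulrDl.
under [RHS]eq_bigr do rewrite big_split/=.
rewrite [RHS]big_split/= [X in _ = X + _](_ : _ = 0) ?add0r; last first.
  under eq_bigr do rewrite -mulr_sumr IH mulr_sumr.
  by apply: sum_offdiag_sym_eq0 => i j; rewrite setD1C.
rewrite [RHS](exchange_big_dep (mem I))/=; last by move=> i j _ /setD1P[].
apply: eq_bigr => i iI; apply: eq_big => [j|j _]; last by rewrite setD1C.
by rewrite !inE iI andbT andbC eq_sym.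
Qed.

(** As [cup ws] is closed, its product with dw is the coboundary of [w * cup ws]; this makes sums
    over a box telescope. *)
Lemma cup_cons w ws I x : cup (w :: ws) I x =
  \sum_(i in I) (w x * cup ws (I :\ i) x +
                 w (step x i) * cup ws (I :\ i) (step x i)).
Proof.
rewrite /=; under eq_bigr do rewrite mulrDl.
rewrite [LHS]big_split/= [RHS]big_split/=; congr (_ + _).
by rewrite -!mulr_sumr cup_closed.
Qed.

(** Paths in the directions of [I] never change coordinate [i], so [w] has no increment along
    them. *)
Lemma cup_eq0 w ws I x i b : w \in ws -> i \notin I ->
  (forall y, y i = x i -> w y = b) -> cup ws I x = 0.
Proof.
elim: ws I x => [//|w' ws IH] I x; rewrite inE => wws iI wb /=.
apply: big1 => j jI; have ij : i != j by apply: contraNneq iI => ->.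
case/predU1P: wws => [<-|wws].
  by rewrite !wb ?step_neq// addbool_self mul0r.
rewrite IH ?mulr0// ?inE ?(negPf iI) ?andbF// => y.
by rewrite step_neq//; exact: wb.
Qed.

(** A nonzero sum contains a path on which every function of [ws] jumps at its edge, and the path
    stays in the cube. *)
Lemma cup_nonconst ws I x : cup ws I x -> forall w, w \in ws ->
  exists y z, [/\ forall j, (x j <= y j <= x j + (j \in I))%N,
                  forall j, (x j <= z j <= x j + (j \in I))%N & w y != w z].
Proof.
elim: ws I x => [//|w' ws IH] I x /= cupx w.
have [i iI] : exists2 i, i \in I &
    (w' x + w' (step x i)) && cup ws (I :\ i) (step x i).
  apply/exists_inP; apply: contraTT cupx => /exists_inPn h.
  by rewrite big1// => i /h /negPf.
have stepi j : step x i j = (x j + (j == i))%N.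
  rewrite /step /set_coord; case: eqP => [->|_]; lia.
move=> /andP[dw cupi]; rewrite inE => /predU1P[->|wws].
  exists x, (step x i); split=> [j|j|]; first by lia.
    by rewrite stepi; case: eqP => [->|_]; rewrite ?iI; lia.
  by move: dw; case: (w' x); case: (w' _).
have [y [z [xy xz wyz]]] := IH _ _ cupi _ wws.
exists y, z; split=> // j; [move: (xy j)|move: (xz j)];
  by rewrite !inE stepi; case: eqP => [->|_]; rewrite ?iI/=; lia.
Qed.

(** * Summation over a box and Stokes' formula modulo 2 *)

Section box_sum.
Variable N : nat.

(** The points summed over are the lower corners of unit cubes, hence [t < N] although the box is
    [0, N]. *)
Fixpoint box_sum s h x : bool :=
  if s is i :: s' then \sum_(t < N) box_sum s' h (set_coord x i t) else h x.

Lemma box_sumD s h h' x :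
  box_sum s (fun y => h y + h' y) x = box_sum s h x + box_sum s h' x.
Proof.
elim: s x => [//|i s IH] x /=.
by rewrite -big_split; apply: eq_bigr => t _; rewrite IH.
Qed.

Lemma box_sum_sum (J : finType) (P : pred J) s
    (h : J -> ('I_d -> nat) -> bool) x :
  box_sum s (fun y => \sum_(j | P j) h j y) x =
  \sum_(j | P j) box_sum s (h j) x.
Proof.
elim: s x => [//|i s IH] x /=.
by rewrite exchange_big; apply: eq_bigr => t _; rewrite IH.
Qed.

Lemma eq_box_sum s h h' x :
    (forall y, (forall j, j \notin s -> y j = x j) -> h y = h' y) ->
  box_sum s h x = box_sum s h' x.
Proof.
elim: s x => [|i s IH] x hh' /=; first exact: hh'.
apply: eq_bigr => t _; apply: IH => y yx; apply: hh' => j.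
by rewrite inE negb_or => /andP[ji js]; rewrite yx// set_coord_neq.
Qed.

Lemma box_sum_eq0 s h x :
    (forall y, (forall j, j \notin s -> y j = x j) -> h y = 0) ->
  box_sum s h x = 0.
Proof.
move=> /(@eq_box_sum _ _ (fun=> 0))->.
by elim: s x => //= i s IH x; rewrite big1.
Qed.

Lemma box_sum_neq0 s h x : box_sum s h x -> (forall j, x j < N)%N ->
  exists2 y, (forall j, y j < N)%N & h y.
Proof.
elim: s x => [|i s IH] x /=; first by exists x.
move=> sumx xN; have [t /IH] : exists t : 'I_N, box_sum s h (set_coord x i t).
  apply/existsP; apply: contraTT sumx => /fintype.existsPn h0.
  by rewrite big1 => [|t _]; [|exact: negbTE (h0 t)].
by apply=> j; rewrite /set_coord; case: ifP.
Qed.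

Lemma set_coordC x i j t u : i != j ->
  set_coord (set_coord x i t) j u = set_coord (set_coord x j u) i t.
Proof.
move=> ij; apply/funext => l; rewrite /set_coord.
by case: (eqVneq l i) => [->|//]; rewrite (negPf ij).
Qed.

Lemma step_set_coord x i j t : i != j ->
  step (set_coord x j t) i = set_coord (step x i) j t.
Proof. by move=> ij; rewrite /step set_coord_neq// set_coordC// eq_sym. Qed.

Lemma box_sum_step s h x i : i \notin s ->
  box_sum s (fun y => h (step y i)) x = box_sum s h (step x i).
Proof.
elim: s x => [//|j s IH] x /=; rewrite inE negb_or => /andP[ij si].
by apply: eq_bigr => t _; rewrite IH// step_set_coord.
Qed.

Lemma sum_telescope (f : nat -> bool) :
  \sum_(t < N) (f t + f t.+1) = f 0%N + f N.
Proof.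
elim: N => [|n IH]; first by rewrite big_ord0 addbool_self.
by rewrite big_ord_recr/= IH addrA -(addrA (f 0%N)) addbool_self addr0.
Qed.

(** Stokes' formula in one direction: interior faces cancel in pairs. *)
Lemma box_sum_diff s h x i : i \notin s ->
  box_sum (i :: s) (fun y => h y + h (step y i)) x =
  box_sum s h (set_coord x i 0) + box_sum s h (set_coord x i N).
Proof.
move=> si /=; rewrite -(sum_telescope (fun t => box_sum s h (set_coord x i t))).
apply: eq_bigr => t _; rewrite box_sumD box_sum_step//.
rewrite (_ : step _ i = set_coord x i t.+1)//.
by apply/funext => j; rewrite /step /set_coord eqxx; case: (j == i).
Qed.

Lemma box_sum_diff_eq0 s h x i : i \in s -> uniq s ->
    (forall y, y i = 0%N -> h y = 0) -> (forall y, y i = N -> h y = 0) ->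
  box_sum s (fun y => h y + h (step y i)) x = 0.
Proof.
elim: s x => [//|j s IH] x; rewrite inE => ijs /= /andP[js us] h0 hN.
have [ij|ij] := eqVneq i j; last first.
  by apply: big1 => t _; rewrite IH//; move: ijs; rewrite (negPf ij).
rewrite -/(box_sum (j :: s) (fun y => h y + h (step y i)) x) ij box_sum_diff//.
by rewrite !box_sum_eq0// => y yx; [apply: hN|apply: h0];
  rewrite ij yx// set_coordE.
Qed.

End box_sum.

Section poincare_miranda.
Variables (N : nat) (w : 'I_d -> ('I_d -> nat) -> bool).
Hypothesis w0 : forall i x, x i = 0%N -> w i x = true.
Hypothesis wN : forall i x, x i = N -> w i x = false.

(* The sum telescopes by [cup_cons]; only the face x_j = 0 of the first
   direction j contributes, since on the faces of the other directions i the increments of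
   w_i vanish. *)
Lemma box_sum_cup s : uniq s ->
  box_sum N s (cup (map w s) [set i in s]) (fun=> 0%N) = true.
Proof.
elim: s => [_|j s IH]; first by rewrite /= set_nil eqxx.
rewrite cons_uniq map_cons => /andP[js us].
have -> : cup (w j :: map w s) [set i in j :: s] = fun x =>
  \sum_(i in j :: s) (w j x * cup (map w s) ([set i in j :: s] :\ i) x +
     w j (step x i) * cup (map w s) ([set i in j :: s] :\ i) (step x i)).
  apply/funext => x; rewrite cup_cons.
  by apply: eq_bigl => i; rewrite inE.
rewrite -[LHS]/(box_sum N (j :: s) _ _) box_sum_sum (bigD1 j) ?mem_head//=.
rewrite [X in _ + X]big1 ?addr0 => [|i /andP[ijs ij]]; last first.
  have {}ijs : i \in s by move: ijs; rewrite inE (negPf ij).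
  rewrite -[LHS]/(box_sum N (j :: s) _ _).
  apply: (@box_sum_diff_eq0 N (j :: s)
    (fun x => w j x * cup (map w s) ([set i in j :: s] :\ i) x))
    => [||y yi|y yi].
  - by rewrite inE ijs orbT.
  - by rewrite /= js.
  - rewrite (@cup_eq0 (w i) _ _ _ i true) ?mulr0 ?map_f ?setD11// => z.
    by rewrite yi; exact: w0.
  - rewrite (@cup_eq0 (w i) _ _ _ i false) ?mulr0 ?map_f ?setD11// => z.
    by rewrite yi; exact: wN.
rewrite -[LHS]/(box_sum N (j :: s) _ _).
rewrite (box_sum_diff N
  (fun x => w j x * cup (map w s) ([set i in j :: s] :\ j) x))//.
rewrite [X in _ + X]box_sum_eq0 ?addr0 => [|y yx]; last first.
  by rewrite wN ?mul0r// yx// set_coordE.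
rewrite (_ : set_coord _ j 0 = fun=> 0%N); last first.
  by apply/funext => i; rewrite /set_coord; case: ifP.
rewrite -[RHS]IH//.
rewrite (_ : [set i in j :: s] :\ j = [set i in s]); last first.
  by apply/setP => i; rewrite !inE; case: eqP => [->|//]; rewrite (negPf js).
apply: eq_box_sum => y yx.
by rewrite w0 ?yx// mul1r.
Qed.

(** Over all directions the cup product sums to 1, so it is nonzero on some cube. *)
Lemma exists_nonconstant_cube : (0 < N)%N ->
  exists2 x, (forall j, x j < N)%N & forall i, exists y z,
    [/\ forall j, (x j <= y j <= (x j).+1)%N,
        forall j, (x j <= z j <= (x j).+1)%N & w i y != w i z].
Proof.
move=> N0; have [|x xN cupx] := box_sum_neq0 (box_sum_cup (enum_uniq 'I_d)).
  by [].
exists x => // i.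
have [|y [z [xy xz wyz]]] := cup_nonconst cupx (w := w i).
  by rewrite map_f ?mem_enum.
by exists y, z; split=> // j; [move: (xy j)|move: (xz j)];
  rewrite inE mem_enum addn1.
Qed.

End poincare_miranda.
End cube.

(* Imported only now: [classical_sets] hides the notations of [finset]. *)
From mathcomp Require Import all_classical all_reals all_analysis.

Local Open Scope classical_set_scope.
Local Open Scope ring_scope.

(** * Lebesgue's covering theorem for grids in metric spaces *)

Section families.
Context {R : realType} {X : metricType R}.
Implicit Types (F : set (set X)) (A U V : set X) (r : R).

Lemma bounded_familyP r F : bounded_family r F <->
  forall U x y, F U -> U x -> U y -> mdist x y <= r.
Proof.
split=> [Fr U x y FU Ux Uy|Fr U FU].
  rewrite -lee_fin (le_trans _ (Fr _ FU))//; apply: ereal_sup_ubound.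
  by exists x => //; exists y.
by apply: ge_ereal_sup => _ [x Ux [y Uy <-]]; rewrite lee_fin (Fr U).
Qed.

Lemma disjoint_familyP r F : disjoint_family r F <->
  forall U V x y, F U -> F V -> U x -> V y -> mdist x y < r -> U = V.
Proof.
split=> [Fr U V x y FU FV Ux Vy|Fr U V FU FV UV].
  apply: contraPP => UV; apply/negP; rewrite -leNgt -lee_fin.
  rewrite (le_trans (Fr _ _ FU FV UV))//; apply: ereal_inf_lbound.
  by exists x => //; exists y.
apply: le_ereal_inf_tmp => _ [x Ux [y Vy <-]]; rewrite lee_fin leNgt.
by apply/negP => /(Fr _ _ _ _ FU FV Ux Vy).
Qed.

(** With families given as partitions by a key, boundedness and disjointness become conditions on
    pairs of points. *)
Definition fibers {T : Type} A (key : X -> T) : set (set X) :=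
  [set [set y | A y /\ key y = key x] | x in A].

Lemma bounded_fibers T A (key : X -> T) r :
  (forall x y, A x -> A y -> key x = key y -> mdist x y <= r) ->
  bounded_family r (fibers A key).
Proof.
move=> h; apply/bounded_familyP => _ x y [z Az <-] [Ax xz] [Ay yz].
by apply: h => //; rewrite xz.
Qed.

Lemma disjoint_fibers T A (key : X -> T) r :
  (forall x y, A x -> A y -> mdist x y < r -> key x = key y) ->
  disjoint_family r (fibers A key).
Proof.
move=> h; apply/disjoint_familyP => _ _ x y [z Az <-] [z' Az' <-].
by move=> [Ax xz] [Ay yz'] /h; rewrite xz yz' => ->.
Qed.

Lemma bigcup_fibers T A (key : X -> T) : \bigcup_(U in fibers A key) U = A.
Proof.
apply/seteqP; split=> [x [_ [y Ay <-]] []//|x Ax].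
by exists [set y | A y /\ key y = key x] => //; exists x.
Qed.

(** Lebesgue's theorem for a coarse copy [phi] of a d-dimensional grid: d families with bounded
    members miss a point of a large box. *)
Lemma grid_not_covered d (phi : ('I_d -> nat) -> X) (F : 'I_d -> set (set X))
    (delta : R) (S : nat) :
  (forall x y, (forall j, x j <= y j + 2 /\ y j <= x j + 2)%N ->
     mdist (phi x) (phi y) < delta) ->
  (forall x y j, (x j)%:R <= (y j)%:R + mdist (phi x) (phi y)) ->
  (forall i, disjoint_family delta (F i)) ->
  (forall i, bounded_family S%:R (F i)) ->
  exists2 x, (forall j, x j < S + 3)%N &
    ~ (\bigcup_i \bigcup_(U in F i) U) (phi x).
Proof.
move=> phi_near phi_far Fdisj Fbd.
pose near1 (x y : 'I_d -> nat) :=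
  forall j, (x j <= (y j).+1 /\ y j <= (x j).+1)%N.
(* [W i] collects the face x_i = 0 and the closed 1-neighbourhoods of the
   members of [F i] that come close to it.  By disjointness, a member of [F i]
   has its whole 1-neighbourhood inside [W i] or outside. *)
pose W i (x : 'I_d -> nat) := x i = 0%N \/ exists U u v,
  [/\ F i U, U (phi u), U (phi v), (u i <= 1)%N & near1 x v].
have sameU i U V x y : F i U -> F i V -> U (phi x) -> V (phi y) ->
    (forall j, x j <= y j + 2 /\ y j <= x j + 2)%N -> U = V.
  move=> FU FV Ux Vy /phi_near.
  exact: (disjoint_familyP _ _).1 (Fdisj i) _ _ _ _ FU FV Ux Vy.
have [||//|p pS Wp] :=
  @exists_nonconstant_cube d (S + 3) (fun i x => `[< W i x >]).
- by move=> i x x0; apply/asboolP; left.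
- move=> i x xS; apply/asboolPn => -[|[U [u [v [FU Uu Uv ui xv]]]]].
    by rewrite xS; lia.
  have := phi_far v u i.
  have := (bounded_familyP _ _).1 (Fbd i) _ _ _ FU Uv Uu.
  move=> h1 h2; have : ((v i)%:R <= (u i + S)%:R :> R).
    by rewrite natrD (le_trans h2)// lerD2l.
  by rewrite ler_nat; have := xv i; lia.
- by rewrite addn3.
exists p => // -[i _ [U FU Up]].
(* If [p] is covered by [F i], then [W i] is constant on the cube at [p]: a vertex is within 1 of
   [p], so a point [v] within 1 of that vertex is within 2 of [p], and disjointness puts both in one
   member. *)
have cube_const y : (forall j, p j <= y j <= (p j).+1)%N -> W i y <-> W i p.
  move=> py; have yp : near1 y p by move=> j; have := py j; lia.
  split.
    move=> [y0|[V [u [v [FV Vu Vv ui yv]]]]].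
      by right; exists U, p, p; split=> //; have := py i; lia.
    right; have UV : U = V.
      by apply: (sameU i _ _ p v) => // j; have := yp j; have := yv j; lia.
    by subst V; exists U, u, p; split=> // j; lia.
  move=> [p0|[V [u [v [FV Vu Vv ui pv]]]]].
    by right; exists U, p, p; split=> //; lia.
  right; have UV : U = V.
    by apply: (sameU i _ _ p v) => // j; have := pv j; lia.
  by subst V; exists U, u, p; split.
have [y [z [py pz]]] := Wp i.
by rewrite (asbool_equiv_eq (cube_const y py))
  (asbool_equiv_eq (cube_const z pz)) eqxx.
Qed.

End families.

(** * The union of the lattices *)

Section distance.
Context {R : realType} {k : nat}.
Implicit Types a b : lattice_union R k.

(** Extension by 0 lets points of different levels be compared without [pad]. *)
Definition coord a (i : nat) : int := oapp (lattice_part a 0) 0 (insub i).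

Lemma coord_ord a (i : 'I_(level a)) : coord a i = lattice_part a 0 i.
Proof. by rewrite /coord valK. Qed.

Lemma coord_out a i : (level a <= i)%N -> coord a i = 0.
Proof. by move=> ai; rewrite /coord insubF// ltnNge ai. Qed.

Lemma coord_dvd a i : ((level a)%:Z %| coord a i)%Z.
Proof.
case: (ltnP i (level a)) => [ia|/coord_out->]; last exact: dvdz0.
rewrite -[coord a i]/(coord a (Ordinal ia)) coord_ord.
exact: (forallP (valP (tagged a).1) (Ordinal ia)).
Qed.

(** This form is symmetric, since one of the two sums is always empty. *)
Lemma lattice_union_dist_le a b r : (lattice_union_dist a b <= r)%N <->
  [/\ forall i, (`|coord a i - coord b i| <= r)%N,
      forall j, (`|bar_part a ord0 j - bar_part b ord0 j| <= r)%N,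
      (\sum_(level a <= i < level b) i <= r)%N &
      (\sum_(level b <= i < level a) i <= r)%N].
Proof.
wlog ab : a b / (level a <= level b)%N => [hwlog|].
  case/orP: (leq_total (level a) (level b)) => [/hwlog//|/hwlog ba].
  rewrite lattice_union_distC; split=> [/ba|] [h1 h2 h3 h4]; last apply/ba;
    by split=> // i; [have := h1 i|have := h2 i]; lia.
rewrite /lattice_union_dist ab /dist_ordered /dmax/= !geq_max.
have padE (i : 'I_(level b)) : pad (level b) (lattice_part a) 0 i = coord a i.
  by rewrite mxE.
split=> [/andP[/andP[/bigmax_leqP h1 /bigmax_leqP h2] h3]|[h1 h2 h3 _]].
  split=> //; last by rewrite big_geq.
    move=> i; case: (ltnP i (level b)) => ib; last first.
      by rewrite !coord_out// (leq_trans ab).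
    by have := h1 (Ordinal ib) isT; rewrite padE -coord_ord.
  by move=> j; exact: h2.
rewrite h3 andbT; apply/andP; split; apply/bigmax_leqP => i _; last exact: h2.
by rewrite padE -coord_ord; exact: h1.
Qed.

Lemma lattice_union_dist_coord a b i :
  (`|coord a i - coord b i| <= lattice_union_dist a b)%N.
Proof. by have /lattice_union_dist_le[] := leqnn (lattice_union_dist a b). Qed.

Lemma lattice_union_dist_bar a b j :
  (`|bar_part a ord0 j - bar_part b ord0 j| <= lattice_union_dist a b)%N.
Proof. by have /lattice_union_dist_le[] := leqnn (lattice_union_dist a b). Qed.

(** Were the levels distinct, the sum in the distance would contain the smaller one, which is at
    least [n]. *)
Lemma level_eq a b n : (n <= level a)%N -> (n <= level b)%N ->
  (lattice_union_dist a b < n)%N -> level a = level b.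
Proof.
move=> na nb dn.
have /lattice_union_dist_le[_ _ h1 h2] := leqnn (lattice_union_dist a b).
by case: (ltngtP (level a) (level b)) => // ab; [move: h1|move: h2];
  rewrite big_ltn//; lia.
Qed.

(** The difference is a multiple of the level and smaller than it. *)
Lemma coord_eq a b i : level a = level b ->
  (lattice_union_dist a b < level a)%N -> coord a i = coord b i.
Proof.
move=> ab dab; have := leq_ltn_trans (lattice_union_dist_coord a b i) dab.
have : ((level a)%:Z %| coord a i - coord b i)%Z.
  by rewrite rpredB ?coord_dvd// ab coord_dvd.
move=> /dvdzP[q qE]; rewrite qE abszM absz_nat -{2}(mul1n (level a)).
rewrite ltn_mul2r ltnS leqn0 absz_eq0 => /andP[_ /eqP q0].
by apply/eqP; rewrite -subr_eq0 qE q0 mul0r.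
Qed.

Lemma scaled_row_subproof l (z : 'I_l -> nat) :
  [forall i, (l%:Z %| (\row_(i < l) (l * z i)%:Z) ord0 i)%Z].
Proof. by apply/forallP => i; rewrite mxE PoszM dvdz_mulr. Qed.

Definition lattice_point l (z : 'I_l.+1 -> nat) (v : 'I_k -> nat) :
    lattice_union R k :=
  existT (fun l => (scaled_lattice l.+1 * 'rV[int]_k)%type) l
    (Sub (\row_i (l.+1 * z i)%:Z) (scaled_row_subproof z), \row_j (v j)%:Z).

Lemma coord_lattice_point l z v (i : 'I_l.+1) :
  coord (lattice_point z v) i = (l.+1 * z i)%:Z.
Proof.
exact: (etrans (@coord_ord (lattice_point z v) i) (mxE _ _ _ _)).
Qed.

Lemma lattice_point_dist_le l (z z' : 'I_l.+1 -> nat) v v' r :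
    (forall i,
       l.+1 * z i <= l.+1 * z' i + r /\ l.+1 * z' i <= l.+1 * z i + r)%N ->
    (forall j, (v j <= v' j + r /\ v' j <= v j + r)%N) ->
  (lattice_union_dist (lattice_point z v) (lattice_point z' v') <= r)%N.
Proof.
move=> hz hv; apply/lattice_union_dist_le; split; rewrite ?big_geq//.
  move=> i; case: (ltnP i l.+1) => il; last by rewrite !coord_out.
  rewrite -[X in coord _ X]/(nat_of_ord (Ordinal il)).
  rewrite -[X in coord (lattice_point z' _) X]/(nat_of_ord (Ordinal il)).
  by rewrite !coord_lattice_point; have := hz (Ordinal il); lia.
by move=> j; rewrite /bar_part/= !mxE; have := hv j; lia.
Qed.

Lemma lattice_point_dist_ge l (z z' : 'I_l.+1 -> nat) v v' :
  let r := lattice_union_dist (lattice_point z v) (lattice_point z' v') in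
  (forall i, z i <= z' i + r)%N /\ (forall j, v j <= v' j + r)%N.
Proof.
move=> r; rewrite {}/r; split=> i.
  have := lattice_union_dist_coord (lattice_point z v) (lattice_point z' v') i.
  by rewrite !coord_lattice_point; nia.
have := lattice_union_dist_bar (lattice_point z v) (lattice_point z' v') i.
by rewrite /bar_part/= !mxE; lia.
Qed.

End distance.

(** * The lower bound *)

Section lower_bound.
Context {R : realType} {k : nat}.
Notation X := (lattice_union R k).

Lemma not_coasdim_le : ~ coasdim_le X k.
Proof.
move=> /(_ 3%N)[r [m [F [r0 F3r]]]] Am.
pose S := (Num.truncn r).+1.
have rS : r <= S%:R by rewrite ltW// /S truncnS_gt.
have Fbd i : bounded_family S%:R (F i).
  apply/bounded_familyP => U x y FU Ux Uy; apply: le_trans rS.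
  exact: (bounded_familyP _ _).1 (F3r i).2 _ _ _ FU Ux Uy.
have section_pt (z : 'I_m.+1 -> nat) : exists v : 'I_k -> nat,
    (forall j, (v j < S + 3)%N) /\
    ~ (\bigcup_i \bigcup_(U in F i) U) (lattice_point z v : X).
  have [|||v vS] := @grid_not_covered R X k (fun v => lattice_point z v)
      F 3 S _ _ _ Fbd.
  - move=> x y xy; rewrite mdist_lattice_unionE ltr_nat ltnS.
    by apply: lattice_point_dist_le => // i; lia.
  - move=> x y j; rewrite mdist_lattice_unionE -natrD ler_nat.
    exact: (lattice_point_dist_ge z z x y).2.
  - by move=> i; have [] := F3r i.
  - by move=> nv; exists v.
have [v vP] := choice section_pt.
(* Grid points within 2 differ by at most 2(m + 1) after scaling; their heights differ by less than
   S + 3. *)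
pose N := (2 * m.+1 + (S + 3))%N.
have [|V [Vbd Vcov]] := Am N.+1%:R; first by rewrite ltr0n.
have [T TV] : exists T : nat, forall i, bounded_family T%:R (V i).
  have /choice[t tV] i : exists t : nat, bounded_family t%:R (V i).
    have [_ [q q0 qV] _] := Vbd i.
    exists (Num.truncn q).+1; apply/bounded_familyP => U x y VU Ux Uy.
    rewrite (le_trans _ (ltW (truncnS_gt q)))//.
    exact: (bounded_familyP _ _).1 qV _ _ _ VU Ux Uy.
  exists (\max_i t i) => i; apply/bounded_familyP => U x y VU Ux Uy.
  rewrite (@le_trans _ _ (t i)%:R)//.
    exact: (bounded_familyP _ _).1 (tV i) _ _ _ VU Ux Uy.
  by rewrite ler_nat; exact: leq_bigmax.
have [|||z _] := @grid_not_covered R X m.+1 (fun z => lattice_point z (v z))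
  V N.+1%:R T _ _ _ TV.
- move=> x y xy; rewrite mdist_lattice_unionE ltr_nat ltnS.
  apply: lattice_point_dist_le => [i|j]; first by have := xy i; rewrite /N; nia.
  by have := (vP x).1 j; have := (vP y).1 j; rewrite /N; lia.
- move=> x y j; rewrite mdist_lattice_unionE -natrD ler_nat.
  exact: (lattice_point_dist_ge x y (v x) (v y)).1.
- by move=> i; have [] := Vbd i.
by apply; apply: Vcov; split=> //; have [] := vP z.
Qed.

End lower_bound.

(** * Colourings of Z by slabs *)

Section slabs.
Variables (D n : nat).
Hypothesis n_gt0 : (0 < n)%N.
Notation P := (D.+1 * n)%N.

(* Z is cut into the slabs [mP + cn, mP + (c + 1)n) of colour c = 0, ..., D,
   where P = (D + 1)n.  [block c] numbers the gaps between the slabs of colour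
   [c]; these gaps are at least [n] apart. *)
Definition in_slab (c : nat) (t : int) : bool :=
  ((c * n)%:Z <= (t %% P)%Z) && ((t %% P)%Z < (c.+1 * n)%:Z).

Definition block (c : nat) (t : int) : int :=
  (t %/ P)%Z + (if (c * n)%:Z <= (t %% P)%Z then 1 else 0).

(** Pigeonhole: slabs of distinct colours are disjoint, so D integers meet at most D of the D + 1
    colours. *)
Lemma exists_free_slab (f : 'I_D -> int) :
  exists c : 'I_D.+1, forall j, ~~ in_slab c (f j).
Proof.
apply: contrapT => /forallNP noc.
have /choice[j jP] (c : 'I_D.+1) : exists j, in_slab c (f j).
  by have /existsNP[j /negP/negPn fj] := noc c; exists j.
suff /leq_card : injective j by rewrite !card_ord ltnn.
move=> c c' jcc'; have := jP c; have := jP c'; rewrite jcc' /in_slab.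
move=> /andP[h1 h2] /andP[h3 h4]; apply/val_inj.
have : (c * n < c'.+1 * n)%N by lia.
have : (c' * n < c.+1 * n)%N by lia.
rewrite !ltn_pmul2r//=; lia.
Qed.

Lemma period_bound (t : int) :
  t = (t %/ P)%Z * P%:Z + (t %% P)%Z /\ 0 <= (t %% P)%Z < P%:Z.
Proof.
have P0 : (0 < P)%N by rewrite muln_gt0.
by split; [exact: divz_eq|rewrite modz_ge0 ?ltz_pmod//; lia].
Qed.

Lemma block_near c t t' : block c t = block c t' -> (`|t - t'| <= 2 * P)%N.
Proof.
have [] := period_bound t; have [] := period_bound t'; rewrite /block.
set a := (t %/ P)%Z; set b := (t %% P)%Z.
set a' := (t' %/ P)%Z; set b' := (t' %% P)%Z.
move=> t'E b'P tE bP; rewrite tE t'E; clearbody a b a' b'.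
move: b'P bP; move: P => p b'P bP.
by case: ifP => _; case: ifP => _ aa'; nia.
Qed.

(** A whole slab of width [n] separates points outside the slabs with different block numbers. *)
Lemma block_far (c : 'I_D.+1) t t' : ~~ in_slab c t -> ~~ in_slab c t' ->
  (`|t - t'| < n)%N -> block c t = block c t'.
Proof.
wlog bb : t t' / block c t <= block c t' => [hwlog st st' tt'|].
  have [/hwlog->//|/ltW/hwlog<-//] := leP (block c t) (block c t').
  by rewrite distnC.
move=> st st' tt'; apply/eqP; rewrite eq_le bb/= leNgt.
apply/negP => {bb} lt_bb.
move: st st' tt' lt_bb.
have cP : (c.+1 * n <= P)%N by rewrite leq_mul2r ltn_ord orbT.
have [] := period_bound t; have [] := period_bound t'; rewrite /block /in_slab.
set a := (t %/ P)%Z; set b := (t %% P)%Z.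
set a' := (t' %/ P)%Z; set b' := (t' %% P)%Z.
move=> t'E b'P tE bP; rewrite tE t'E; clearbody a b a' b'; move: cP b'P bP.
rewrite mulSn; move: (c * n)%N P => C p cP b'P bP.
(* The quotients differ by at least 0, 1 or 2, depending on the sides of the slabs; [lia] needs
   these bounds multiplied by the period. *)
have aa' (e : int) : a + e <= a' -> e * p%:Z <= a' * p%:Z - a * p%:Z.
  by move=> ae; rewrite -mulrBl ler_wpM2r//; lia.
have := aa' 0; have := aa' 1; have := aa' 2.
by case: (leP C%:Z b); case: (leP C%:Z b') => /=; lia.
Qed.

End slabs.

Lemma sum_nat_interval_le m n L : (n <= L)%N ->
  (\sum_(m <= i < n) i <= \sum_(0 <= i < L) i)%N.
Proof.
move=> nL; have [mn|nm] := leqP m n; last by rewrite big_geq// ltnW.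
rewrite [leqRHS](big_cat_nat (leq0n n) nL).
rewrite [X in (_ <= X + _)%N](big_cat_nat (leq0n m) mn).
by rewrite /= -addnA addnCA leq_addr.
Qed.

(** * The upper bound *)

Section upper_bound.
Context {R : realType} {k : nat}.
Notation X := (lattice_union R k).
Implicit Types (A : set X).

(** Zero padding maps [A] to Z^(L + k) and loses only the level term of the distance, which is
    bounded on [A]; so families of boxes pull back. *)
Lemma asdim_le_bounded_level A L : (forall a, A a -> (level a <= L)%N) ->
  asdim_le A (L + k).
Proof.
move=> AL r r0; pose n := (Num.truncn r).+1.
pose f (a : X) (j : 'I_(L + k)) : int :=
  match fintype.split j with inl i => coord a i | inr i => bar_part a 0 i end.
have f_le (a b : X) j : (`|f a j - f b j| <= lattice_union_dist a b)%N.
  rewrite /f; case: fintype.split => i; first exact: lattice_union_dist_coord.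
  exact: lattice_union_dist_bar.
pose G c := [set a | A a /\ forall j, ~~ in_slab (L + k) n c (f a j)].
exists (fun c => fibers (G c) (fun a j => block (L + k) n c (f a j))); split.
  move=> c; split=> [U [a _ <-] b [[]]//||].
    pose M := maxn (2 * ((L + k).+1 * n)) (\sum_(0 <= i < L) i)%N.
    exists M.+1%:R; first by rewrite ltr0n.
    apply: bounded_fibers => a b [Aa _] [Ab _] /funeqP key.
    rewrite mdist_lattice_unionE ler_nat leqW//.
    have fM j : (`|f a j - f b j| <= M)%N.
      by rewrite leq_max (@block_near _ _ _ c).
    have sumM (u v : X) : A v -> (\sum_(level u <= i < level v) i <= M)%N.
      by move=> Av; rewrite leq_max sum_nat_interval_le ?orbT//; exact: AL.
    apply/lattice_union_dist_le; split; [move=> i|move=> i|exact: sumM..].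
      have [iL|iL] := ltnP i L; last first.
        by rewrite !coord_out// (leq_trans _ iL) ?AL.
      have := fM (lshift k (Ordinal iL)).
      by rewrite /f (unsplitK (inl _)).
    by have := fM (rshift L i); rewrite /f (unsplitK (inr _)).
  apply: disjoint_fibers => a b [_ Ga] [_ Gb].
  rewrite mdist_lattice_unionE => abr; apply/funext => j.
  apply: block_far => //; rewrite (leq_ltn_trans (f_le _ _ _))//.
  by rewrite -(ltr_nat R) (lt_trans abr)// truncnS_gt.
move=> a Aa; have [c fc] := @exists_free_slab (L + k) n isT (f a).
by exists c => //; rewrite bigcup_fibers.
Qed.

Lemma coasdim_le_succ : coasdim_le X k.+1.
Proof.
move=> n.
(* Width n + 1 keeps the slabs nonempty when n = 0. *)
pose G c := [set a : X | (n < level a)%N /\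
  forall j, ~~ in_slab k n.+1 c (bar_part a 0 j)].
pose key c (a : X) :=
  (level a, coord a, fun j => block k n.+1 c (bar_part a 0 j)).
exists (2 * (k.+1 * n.+1)).+1%:R, (n + k)%N, (fun c => fibers (G c) (key c)).
split; first by rewrite ltr0n.
  move=> c; split.
    apply: disjoint_fibers => a b [na Ga] [nb Gb].
    rewrite mdist_lattice_unionE ltr_nat => abn.
    have lab : level a = level b.
      by apply: level_eq (ltnW na) (ltnW nb) abn.
    rewrite /key lab; congr (_, _, _); apply/funext => i.
      by apply: coord_eq => //; apply: ltn_trans na.
    apply: block_far => //.
    by rewrite (leq_ltn_trans (lattice_union_dist_bar _ _ _))// ltnW.
  apply: bounded_fibers => a b _ _ [lab /funeqP cab /funeqP bab].
  rewrite mdist_lattice_unionE ler_nat leqW//.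
  have lev : level a = level b by rewrite /level lab.
  apply/lattice_union_dist_le; split; rewrite ?lev ?big_geq//.
    by move=> i; rewrite cab subrr.
  by move=> j; apply: block_near (bab j).
(* Every point above level [n] has a free colour, so the uncovered part has level at most [n]. *)
apply: asdim_le_bounded_level => a [_]; apply: contra_notP => /negP.
rewrite -ltnNge => na.
have [c fc] := @exists_free_slab k n.+1 isT (bar_part a 0).
by exists c => //; rewrite bigcup_fibers.
Qed.

End upper_bound.

Theorem theorem3p1 (R : realType) (k : nat) (hk : (1 <= k)%N) :
  coasdim_eq (lattice_union R k) (k + 1)%N.
Proof.
rewrite addn1; split; [exact: coasdim_le_succ|exact: not_coasdim_le].
Qed.
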